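(* Let $F$ be a finite metric subspace of the unit sphere $\mathbb S^\infty$ in an infinite-dimensional Hilbert space. Let all subspaces of $\mathbb S^\infty$ isometric to $F$ be coloured using finitely many colours. Then for every finite subspace $Y$ of the sphere $\mathbb S^\infty$ and every $\varepsilon>0$ there is a subspace $Y'\subseteq\mathbb S^\infty$ isometric to $Y$ such that the set of all subspaces of $Y'$ isometric to $F$ is monochromatic up to $\varepsilon$.
   Context: The sphere carries the Euclidean (norm) distance. The set of subspaces of $\mathbb S^\infty$ isometric to $F$ is regarded as the quotient, by the group $\mathrm{Iso}(F)$ of isometries of $F$ acting by precomposition, of the set of isometric embeddings $F\hookrightarrow\mathbb S^\infty$ equipped with the metric $d_{\sup}(i,j)=\max\{\|i(x)-j(x)\| : x\in F\}$; thus the distance between two such subspaces $F_1,F_2$ is the minimum of $d_{\sup}(i,j)$ over isometric embeddings $i,j$ of $F$ with $i(F)=F_1$, $j(F)=F_2$. A colouring with finitely many colours is a finite partition $\gamma$; a set of subspaces is monochromatic up to $\varepsilon$ if it is contained in the $\varepsilon$-neighbourhood of some member of $\gamma$. *)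

(* Defs.v *)
From HB Require Import structures.
From mathcomp Require Import all_boot all_order all_algebra.
From mathcomp Require Import finmap.
From mathcomp Require Import all_classical all_reals all_analysis.

Set Implicit Arguments.
Unset Strict Implicit.
Unset Printing Implicit Defensive.

Import Order.TTheory GRing.Theory Num.Theory.
Import numFieldNormedType.Exports.

Local Open Scope classical_set_scope.
Local Open Scope ring_scope.

Definition infinite_dimensional (R : realType) (V : lmodType R) : Prop :=
  ~ exists s : seq V,
      forall x : V, exists a : 'I_(size s) -> R, x = \sum_i a i *: s`_i.

(* Scalars are real. A complex Hilbert space is covered by restricting scalars
   to R and taking the real part of its inner product: the norm, hence
   everything below, is unchanged. *)
Definition inner_product_norm (R : realType) (H : normedModType R)
    (dot : {dot H for idfun}) : Prop :=
  forall x : H, `|x| ^+ 2 = dot x x.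

Section Copies.
Context {R : realType} {H : normedModType R}.
Implicit Types (F : set H) (i j : H -> H).

Definition sphere1 : set H := [set x | `|x| = 1].

(* A map F -> sphere1 is represented by a total function on H whose values
   outside F are irrelevant. *)
Definition isometric_embedding F i : Prop :=
  (forall x, F x -> sphere1 (i x)) /\
  (forall x y, F x -> F y -> `|i x - i y| = `|x - y|).

Definition copies F : set (set H) :=
  [set F' | exists2 i, isometric_embedding F i & i @` F = F'].

(* Meant for finite F; all terms are nonnegative, so the base value 0 only
   matters when F is empty. *)
Definition dsup F i j : R :=
  \big[Num.max/0]_(x <- fset_set F) `|i x - j x|.

(* For finite F, and F1 and F2 in copies F, the set below is nonempty and
   finite (an embedding of F onto F1 is, on F, one of finitely many
   bijections), so the infimum is a minimum. *)
Definition copy_dist F (F1 F2 : set H) : R :=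
  inf [set d | exists i j,
    [/\ isometric_embedding F i, isometric_embedding F j,
        i @` F = F1, j @` F = F2 & d = dsup F i j]].

Definition copy_nbhd F (P : set (set H)) (eps : R) : set (set H) :=
  [set F1 | copies F F1 /\ exists2 F2, P F2 & copy_dist F F1 F2 < eps].

Definition monochromatic_upto F (gamma : set (set (set H))) (eps : R)
    (A : set (set H)) : Prop :=
  exists2 P, gamma P & A `<=` copy_nbhd F P eps.

End Copies.

(* Main.v *)
Require Import Defs.
From HB Require Import structures.
From mathcomp Require Import all_boot all_order all_algebra.
From mathcomp Require Import all_classical all_reals all_analysis.
From mathcomp Require Import ring lra zify.
Import Order.TTheory GRing.Theory Num.Theory.
Import numFieldNormedType.Exports.

(** The proof is the concentration of measure argument for the orthogonal
    group acting on many blocks, with finite sets in place of Haar measure,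
    so that arbitrary colourings can be treated by counting.

    Let R^n be the span of the union of F and Y. Every isometric embedding e
    of F into Y is the restriction of an orthogonal matrix g_e of R^n
    ([orthogonal_extension]). Choose a finite family x_1, ..., x_k of
    orthogonal matrices on which each g_e acts by left multiplication as a
    permutation sigma_e of the indices, up to a small error
    ([quasi_invariant_family]). A net of minimal cardinality in the
    orthogonal group has this property ([minimal_net_permuted]), by the
    marriage theorem ([hall]).

    A word w of length N over the alphabet {1, ..., k} gives an isometric
    embedding of R^n into H: put v x_(w_1), ..., v x_(w_N), divided by the
    square root of N, in N orthogonal blocks. Restricted to F this colours
    the words. Two words that differ in few places give embeddings that are
    close on the unit sphere, because the squared distance is an average
    over the N blocks. And up to the small error, e followed by the
    embedding given by w is the embedding of F given by the word sigma_e(w).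

    So it suffices to find one word w such that all the words sigma_e(w)
    are, in Hamming distance, close to words of one and the same colour
    ([near_monochromatic]). Some colour has a fixed positive proportion of
    all words, and as N grows almost all words become close to it. Only a
    variance bound for Hamming-Lipschitz functions ([product_variance]) and
    the inequality of Chebyshev are needed for this. Since each sigma_e
    permutes the words and there are finitely many e, a union bound gives w.
    The image of Y under the embedding given by w is the required copy of Y. *)

Set Implicit Arguments.
Unset Strict Implicit.
Unset Printing Implicit Defensive.

(** * The marriage theorem *)

Definition neighbours (T U : finType) (e : {set T * U}) (A : {set T}) :
    {set U} :=
  [set y | [exists x in A, (x, y) \in e]].

Definition hall_condition (T U : finType) (e : {set T * U}) : Prop :=
  forall A : {set T}, #|A| <= #|neighbours e A|.

Lemma neighboursP (T U : finType) (e : {set T * U}) (A : {set T}) y :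
  reflect (exists2 x, x \in A & (x, y) \in e) (y \in neighbours e A).
Proof. by rewrite inE; apply: (iffP exists_inP). Qed.

(** Deleting an edge at x can only destroy the Hall condition on a set
    containing x.  If both deletions destroy it, on A1 and on A2, then the two
    deficient neighbourhoods together cover all neighbours of the union of A1
    and A2, and their intersection contains all neighbours of the intersection
    of A1 and A2 minus x.  Submodularity of cardinality then contradicts the
    Hall condition for these two sets. *)
Lemma hall_delete_edge (T U : finType) (e : {set T * U}) x y1 y2 :
    hall_condition e -> y1 != y2 ->
  hall_condition (e :\ (x, y1)) \/ hall_condition (e :\ (x, y2)).
Proof.
move=> he y12.
have viol y :
    ~~ [forall A : {set T}, #|A| <= #|neighbours (e :\ (x, y)) A|] ->
    exists2 A : {set T}, x \in A & #|neighbours (e :\ (x, y)) A| < #|A|.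
  rewrite negb_forall => /existsP [A]; rewrite -ltnNge => hA.
  exists A => //; apply: contraLR hA => xA; rewrite -leqNgt.
  apply: leq_trans (he A) _; apply: subset_leq_card; apply/fintype.subsetP => z.
  case/neighboursP => x' x'A ez; apply/neighboursP; exists x' => //.
  rewrite finset.in_setD1 ez andbT; apply: contraNneq xA => -[<- _] //.
have [/forallP|h1] :=
  boolP [forall A : {set T}, #|A| <= #|neighbours (e :\ (x, y1)) A|].
  by left.
have [/forallP|h2] :=
  boolP [forall A : {set T}, #|A| <= #|neighbours (e :\ (x, y2)) A|].
  by right.
have [A1 xA1 lt1] := viol y1 h1; have [A2 xA2 lt2] := viol y2 h2.
set N1 := neighbours _ A1 in lt1; set N2 := neighbours _ A2 in lt2.
have subU : neighbours e (A1 :|: A2) \subset N1 :|: N2.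
  apply/fintype.subsetP => z /neighboursP [x' x'A ez]; rewrite finset.in_setU.
  have [xx'|nxx'] := eqVneq x' x.
    rewrite xx' in ez.
    have [zy1|nzy1] := eqVneq z y1.
      apply/orP; right; apply/neighboursP; exists x => //.
      by rewrite finset.in_setD1 ez andbT xpair_eqE eqxx zy1.
    apply/orP; left; apply/neighboursP; exists x => //.
    by rewrite finset.in_setD1 ez andbT xpair_eqE eqxx.
  have h y : (x', z) \in e :\ (x, y).
    by rewrite finset.in_setD1 ez andbT xpair_eqE negb_and nxx'.
  by move: x'A; rewrite finset.in_setU => /orP[] x'A; apply/orP; [left|right];
    apply/neighboursP; exists x'.
have subI : neighbours e ((A1 :&: A2) :\ x) \subset N1 :&: N2.
  apply/fintype.subsetP => z /neighboursP [x'].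
  rewrite finset.in_setD1 finset.in_setI.
  case/and3P => nxx' x'1 x'2 ez.
  have h y : (x', z) \in e :\ (x, y).
    by rewrite finset.in_setD1 ez andbT xpair_eqE negb_and nxx'.
  by rewrite finset.in_setI; apply/andP; split; apply/neighboursP; exists x'.
have leU := leq_trans (he _) (subset_leq_card subU).
have leI := leq_trans (he _) (subset_leq_card subI).
have := cardsUI N1 N2; have := cardsUI A1 A2.
have := cardsD1 x (A1 :&: A2); rewrite finset.in_setI xA1 xA2 /=.
lia.
Qed.

(** Rado's proof of the marriage theorem: while some vertex has two neighbours,
    one of the two edges can be deleted; once no edge can be deleted the graph
    itself is an injective function. *)
Theorem hall (T U : finType) (e : {set T * U}) :
  hall_condition e ->
  exists2 f : T -> U, injective f & forall x, (x, f x) \in e.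
Proof.
have [m] := ubnP #|e|; elim: m e => // m IHm e ltem he.
have del x y : (x, y) \in e -> hall_condition (e :\ (x, y)) ->
    exists2 f : T -> U, injective f & forall x, (x, f x) \in e.
  move=> exy /IHm [|f injf fe].
    by move: ltem; rewrite (cardsD1 (x, y)) exy.
  by exists f => // z; have := fe z; rewrite finset.in_setD1 => /andP[].
case/boolP: [exists x, exists y1, exists y2,
    [&& y1 != y2, (x, y1) \in e & (x, y2) \in e]].
  case/existsP => x /existsP [y1] /existsP [y2] /and3P [y12 e1 e2].
  by have [] := hall_delete_edge x he y12; apply: del.
move=> uniq_nb.
have uniqe x y1 y2 : (x, y1) \in e -> (x, y2) \in e -> y1 = y2.
  move=> e1 e2; apply/eqP; apply: contraNT uniq_nb => y12.
  apply/existsP; exists x; apply/existsP; exists y1; apply/existsP; exists y2.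
  exact/and3P.
have ex x : {y | (x, y) \in e}.
  apply: sigW; have := he [set x]; rewrite cards1 card_gt0 => /set0Pn [y].
  by case/neighboursP => _ /finset.set1P -> ; exists y.
exists (fun x => sval (ex x)) => [x x'|x]; last exact: (svalP (ex x)).
move=> fxx'; apply/eqP; apply/negPn/negP => nxx'.
have := he [set x; x']; rewrite cards2 nxx' leqNgt => /negP; apply.
rewrite ltnS [nat_of_bool _]/= -(cards1 (sval (ex x))); apply: subset_leq_card.
apply/fintype.subsetP => z /neighboursP [t /finset.set2P[] -> etz];
  apply/finset.set1P.
  by rewrite (uniqe _ _ _ etz (svalP (ex x))).
by rewrite (uniqe _ _ _ etz (svalP (ex x'))).
Qed.

Local Open Scope ring_scope.

(** * Concentration in product spaces *)

Definition hamming (T : eqType) N (w w' : N.-tuple T) : nat :=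
  (\sum_(t < N) (tnth w t != tnth w' t))%N.

Definition agreement (T : eqType) N (w w' : N.-tuple T) : nat :=
  (\sum_(t < N) (tnth w t == tnth w' t))%N.

Lemma agreementD_hamming (T : eqType) N (w w' : N.-tuple T) :
  (agreement w w' + hamming w w' = N)%N.
Proof.
rewrite -big_split /= -[RHS]card_ord -sum1_card; apply: eq_bigr => t _.
by case: eqP.
Qed.

Lemma agreement_lipschitz (T : eqType) N (w w' a : N.-tuple T) :
  (agreement w a <= agreement w' a + hamming w w')%N.
Proof.
rewrite -big_split /=; apply: leq_sum => t _.
case: (tnth w t =P tnth w' t) => [->|_]; first by rewrite addn0.
exact: leq_trans (leq_b1 _) (leq_addl _ _).
Qed.

Lemma hammingC (T : eqType) N (w w' : N.-tuple T) : hamming w w' = hamming w' w.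
Proof. by apply: eq_bigr => t _; rewrite eq_sym. Qed.

Lemma hamming_cons (T : eqType) N a b (u v : N.-tuple T) :
  hamming (cons_tuple a u) (cons_tuple b v) = ((a != b) + hamming u v)%N.
Proof.
rewrite /hamming big_ord_recl !tnth0; congr (_ + _)%N.
by apply: eq_bigr => t _; rewrite !tnthS.
Qed.

Lemma sum_tuple_cons (R : nmodType) (T : finType) N (f : N.+1.-tuple T -> R) :
  \sum_w f w = \sum_a \sum_(u : N.-tuple T) f (cons_tuple a u).
Proof.
rewrite pair_bigA /=.
rewrite (reindex (fun p : T * N.-tuple T => cons_tuple p.1 p.2)) //=.
exists (fun w => (thead w, behead_tuple w)) => [[a u]|w] _ /=.
  by congr pair; apply: val_inj.
by apply: val_inj; case/tupleP: w => a u /=.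
Qed.

Lemma sum_sqr_diff (R : comPzRingType) (I : finType) (f : I -> R) :
  \sum_i \sum_j (f i - f j) ^+ 2 =
  (#|I|%:R * (\sum_i f i ^+ 2) - (\sum_i f i) ^+ 2) *+ 2.
Proof.
under eq_bigr => i _.
  under eq_bigr => j _ do rewrite sqrrB.
  rewrite big_split sumrB /= sumr_const sumrMnl -mulr_sumr.
over.
rewrite big_split sumrB /= sumr_const !sumrMnl -mulr_suml.
rewrite -[#|xpredT|]/#|I| -[(\sum_i f i ^+ 2) *+ _]mulr_natl; ring.
Qed.

(** The Efron-Stein inequality in unnormalised form: the left-hand side is twice
    the variance of f for the uniform measure, times the square of the number of
    words.  In the induction the variance splits into the mean of the variances
    in the last N letters and the variance of the conditional mean, which is F
    up to normalisation and varies by at most 1. *)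
Lemma product_variance (R : realFieldType) (T : finType) N
    (f : N.-tuple T -> R) :
    (forall w w', `|f w - f w'| <= (hamming w w')%:R) ->
  \sum_w \sum_w' (f w - f w') ^+ 2 <= N%:R * (#|T|%:R ^+ N) ^+ 2.
Proof.
elim: N f => [|N IHN] f lipf.
  rewrite mul0r big1// => w _; rewrite big1// => w' _.
  by rewrite (tuple0 w) (tuple0 w') subrr expr0n.
pose F a := \sum_(u : N.-tuple T) f (cons_tuple a u).
have cT : #|{: N.-tuple T}|%:R = #|T|%:R ^+ N :> R by rewrite card_tuple natrX.
have split_var : \sum_w \sum_w' (f w - f w') ^+ 2 =
    #|T|%:R * (\sum_a \sum_(u : N.-tuple T) \sum_(v : N.-tuple T)
       (f (cons_tuple a u) - f (cons_tuple a v)) ^+ 2)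
    + \sum_a \sum_b (F a - F b) ^+ 2.
  rewrite !sum_sqr_diff card_tuple natrX.
  under [in RHS]eq_bigr => a _ do
    rewrite (sum_sqr_diff (fun u : N.-tuple T => f (cons_tuple a u))) cT.
  rewrite !sum_tuple_cons sumrMnl sumrB -mulr_sumr -/F exprS; ring.
have F_lip a b : (F a - F b) ^+ 2 <= (#|T|%:R ^+ N) ^+ 2.
  rewrite -[leLHS]real_normK ?num_real// ler_sqr ?nnegrE ?exprn_ge0//.
  rewrite -sumrB; apply: le_trans (ler_norm_sum _ _ _) _.
  rewrite -cT -sum1_card natr_sum; apply: ler_sum => u _.
  apply: le_trans (lipf _ _) _; rewrite hamming_cons ler_nat.
  by rewrite /hamming big1 ?addn0 ?leq_b1// => t _; rewrite eqxx.
have IH a : \sum_(u : N.-tuple T) \sum_(v : N.-tuple T)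
       (f (cons_tuple a u) - f (cons_tuple a v)) ^+ 2
       <= N%:R * (#|T|%:R ^+ N) ^+ 2.
  apply: IHN => u v; apply: le_trans (lipf _ _) _.
  by rewrite hamming_cons eqxx.
rewrite split_var.
have le1 : \sum_a \sum_b (F a - F b) ^+ 2 <= #|T|%:R ^+ 2 * (#|T|%:R ^+ N) ^+ 2.
  apply: (@le_trans _ _ (\sum_(a : T) \sum_(b : T) (#|T|%:R ^+ N) ^+ 2)).
    by apply: ler_sum => a _; apply: ler_sum => b _.
  by rewrite !sumr_const -mulrnA -[leLHS]mulr_natl natrM expr2.
have le2 := ler_sum (index_enum T) (fun a (_ : true) => IH a).
apply: le_trans (lerD (ler_wpM2l (ler0n _ _) le2) le1) _.
rewrite sumr_const -[#|xpredT|]/#|T| -[_ *+ #|T|]mulr_natl.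
rewrite [_ ^+ N.+1]exprS -natr1; set k := #|T|%:R; set P := k ^+ N.
by rewrite le_eqVlt; apply/orP; left; apply/eqP; ring.
Qed.

(** The function M, the largest agreement of a word with a word of A, is
    1-Lipschitz, equals N on A and is at most N - d on B, so each pair in A * B
    contributes at least d ^+ 2 to the variance sum. *)
Lemma concentration (R : realFieldType) (T : finType) N
    (A B : {set N.-tuple T}) (d : R) :
    0 <= d -> (forall a b, a \in A -> b \in B -> d <= (hamming b a)%:R) ->
  #|A|%:R * #|B|%:R * d ^+ 2 <= N%:R * (#|T|%:R ^+ N) ^+ 2.
Proof.
move=> d0 far; pose M w := (\max_(a in A) agreement w a)%N.
have M_lip w w' : (M w <= M w' + hamming w w')%N.
  apply/bigmax_leqP => a aA; apply: leq_trans (agreement_lipschitz w w' a) _.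
  by rewrite leq_add2r; apply: (leq_bigmax_cond (F := agreement w')).
have lip w w' : `|(M w)%:R - (M w')%:R| <= (hamming w w')%:R :> R.
  have := M_lip w w'; have := M_lip w' w; rewrite (hammingC w').
  rewrite -!(ler_nat R) !natrD ler_norml => h1 h2.
  by apply/andP; split; lra.
apply: le_trans (product_variance lip).
have gap a b : a \in A -> b \in B -> d ^+ 2 <= ((M a)%:R - (M b)%:R) ^+ 2 :> R.
  move=> aA bB; suff le_d : d <= (M a)%:R - (M b)%:R.
    by rewrite ler_sqr ?nnegrE// (le_trans d0).
  have [|a' a'A eqa'] := eq_bigmax_cond (agreement b) (A := mem A).
    by apply/card_gt0P; exists a.
  rewrite -/(M b) in eqa'; rewrite eqa'.
  have := far _ _ a'A bB.
  have : (N <= M a)%N.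
    apply: leq_trans (leq_bigmax_cond (F := agreement a) _ aA).
    rewrite -{1}(agreementD_hamming a a) /hamming big1 ?addn0// => t _.
    by rewrite eqxx.
  rewrite -(ler_nat R) -{1}(agreementD_hamming b a') natrD; lra.
apply: (@le_trans _ _
  (\sum_(w in A) \sum_(w' in B) ((M w)%:R - (M w')%:R) ^+ 2)).
  rewrite -[#|A|]sum1_card -[#|B|]sum1_card !natr_sum -mulrA mulr_suml.
  apply: ler_sum => a aA; rewrite mul1r mulr_suml; apply: ler_sum => b bB.
  by rewrite mul1r gap.
rewrite [leRHS](bigID (mem A)) /= -[leLHS]addr0; apply: lerD.
  apply: ler_sum => a _; rewrite [leRHS](bigID (mem B)) /= -[leLHS]addr0.
  by apply: lerD => //; apply: sumr_ge0 => b _; apply: sqr_ge0.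
by apply: sumr_ge0 => a _; apply: sumr_ge0 => b _; apply: sqr_ge0.
Qed.

(** Most words lie close to a colour class of positive density. Each s j
    permutes the words, so the words that s j moves far from that class are
    as few as the words far from it; fewer than a fraction 1 / #|J| when N
    is large, so some word is good for all j at once. *)
Theorem near_monochromatic (R : archiRealFieldType) (T C J : finType)
    (s : J -> T -> T) (delta : R) :
    T -> (forall j, injective (s j)) -> 0 < delta ->
  exists2 N : nat, (0 < N)%N & forall chi : N.-tuple T -> C,
    exists (w : N.-tuple T) (c : C), forall j, exists2 w' : N.-tuple T,
      chi w' = c & (hamming (map_tuple (s j) w) w')%:R <= delta * N%:R.
Proof.
move=> x0 s_inj d0.
(* B below will have density at most #|C| / (delta ^+ 2 * N), to be less
   than 1 / #|J|. *)
pose N := (Num.truncn ((#|C| * #|J|)%:R / delta ^+ 2)).+1.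
have ltN : (#|C| * #|J|)%:R < delta ^+ 2 * N%:R.
  by rewrite mulrC -ltr_pdivrMr ?exprn_gt0// truncnS_gt.
exists N => // chi; pose W := #|T|%:R ^+ N : R.
have W0 : 0 < W by rewrite exprn_gt0// ltr0n; apply/card_gt0P; exists x0.
pose A c := [set w | chi w == c].
have sumA : \sum_c #|A c|%:R = W.
  rewrite /W -natrX -card_tuple -natr_sum -sum1_card; congr _%:R.
  rewrite (partition_big chi xpredT)//=; apply: eq_bigr => c _.
  by rewrite -sum1_card; apply: eq_bigl => w; rewrite inE.
have [c leA] : exists c, W <= #|C|%:R * #|A c|%:R.
  apply/existsP; apply: contraT; rewrite negb_exists => /forallP small.
  have C0 : (0 < #|C|)%N.
    by apply/card_gt0P; exists (chi [tuple of nseq N x0]).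
  have : \sum_(c : C) #|C|%:R * #|A c|%:R < \sum_(c : C) W.
    apply: ltr_sum => [|c _]; last by rewrite ltNge small.
    by case/card_gt0P: C0 => c _; apply/hasP; exists c; rewrite ?mem_index_enum.
  by rewrite -mulr_sumr sumA sumr_const mulr_natl ltxx.
pose B := [set b | [forall a in A c, delta * N%:R < (hamming b a)%:R]].
have [w wB|allB] := pickP (fun w => [forall j, map_tuple (s j) w \notin B]).
  exists w, c => j; have := forallP wB j.
  rewrite inE negb_forall => /existsP [w'].
  by rewrite negb_imply -leNgt inE => /andP[/eqP]; exists w'.
have leB : W <= (#|J| * #|B|)%:R.
  rewrite /W -natrX -card_tuple ler_nat.
  rewrite -[leqLHS]sum1_card -sum_nat_const.
  apply: (@leq_trans (\sum_(w in {: N.-tuple T}) \sum_(j in J)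
    (map_tuple (s j) w \in B))).
    apply: leq_sum => w _; have := allB w => /negbT; rewrite negb_forall.
    case/existsP=> j; rewrite negbK => jB.
    by rewrite (bigD1 j)//= jB.
  rewrite exchange_big; apply: leq_sum => j _; rewrite -big_mkcond sum1dep_card.
  rewrite -(card_imset _ (f := map_tuple (s j))).
    apply: subset_leq_card; apply/fintype.subsetP => _ /imsetP [w + ->].
    by rewrite inE.
  by move=> u v /(congr1 val) /= /(inj_map (@s_inj j)) /val_inj.
have N0 : 0 < N%:R :> R by rewrite ltr0n.
have d_ge0 : 0 <= delta * N%:R by rewrite mulr_ge0// ltW.
have far a b : a \in A c -> b \in B -> delta * N%:R <= (hamming b a)%:R.
  by move=> aA; rewrite inE => /forall_inP /(_ _ aA) /ltW.
have conc := concentration d_ge0 far.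
have {}conc : #|A c|%:R * #|B|%:R * (delta ^+ 2 * N%:R) <= W ^+ 2.
  rewrite -(ler_pM2l N0); apply: le_trans conc; rewrite -/W.
  by rewrite le_eqVlt; apply/orP; left; apply/eqP; ring.
have A0 : 0 < #|A c|%:R :> R.
  have := lt_le_trans W0 leA; rewrite -natrM !ltr0n muln_gt0.
  by case/andP.
have B0 : 0 < #|B|%:R :> R.
  have := lt_le_trans W0 leB; rewrite !ltr0n muln_gt0.
  by case/andP.
have AB0 : 0 < #|A c|%:R * #|B|%:R :> R by rewrite mulr_gt0.
rewrite natrM in leB; rewrite natrM in ltN.
have leW := ler_pM (ltW W0) (ltW W0) leA leB.
have ltW' : #|A c|%:R * #|B|%:R * (#|C|%:R * #|J|%:R) < W ^+ 2.
  by apply: lt_le_trans conc; rewrite ltr_pM2l.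
by move: ltW'; rewrite ltNge mulrC mulrACA expr2 leW.
Qed.

(** * Orthogonal matrices *)

Definition dotv (R : comPzRingType) n (u v : 'rV[R]_n) : R := (u *m v^T) 0 0.

Notation sqnorm v := (dotv v v).

Definition orthogonal_mx (R : pzRingType) n (g : 'M[R]_n) : Prop :=
  g *m g^T = 1%:M.

Section DotV.
Variables (R : comPzRingType) (n : nat).
Implicit Types u v w : 'rV[R]_n.

Lemma dotvE u v : dotv u v = \sum_j u 0 j * v 0 j.
Proof. by rewrite /dotv mxE; apply: eq_bigr => j _; rewrite mxE. Qed.

Lemma mulmx_dotv u v : u *m v^T = (dotv u v)%:M.
Proof. by rewrite -mx11_scalar. Qed.

Lemma dotvC u v : dotv u v = dotv v u.
Proof. by rewrite !dotvE; apply: eq_bigr => j _; rewrite mulrC. Qed.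

Lemma dotvDr u v w : dotv u (v + w) = dotv u v + dotv u w.
Proof. by rewrite /dotv linearD mulmxDr mxE. Qed.

Lemma dotvBr u v w : dotv u (v - w) = dotv u v - dotv u w.
Proof. by rewrite /dotv linearB mulmxBr !mxE. Qed.

Lemma dotvDl u v w : dotv (u + v) w = dotv u w + dotv v w.
Proof. by rewrite /dotv mulmxDl mxE. Qed.

Lemma dotvBl u v w : dotv (u - v) w = dotv u w - dotv v w.
Proof. by rewrite /dotv mulmxBl !mxE. Qed.

Lemma dotv_orthogonal g u v :
  orthogonal_mx g -> dotv (u *m g) (v *m g) = dotv u v.
Proof. by move=> og; rewrite /dotv trmx_mul mulmxA -(mulmxA u) og mulmx1. Qed.

Lemma orthogonal_mxM (g h : 'M[R]_n) :
  orthogonal_mx g -> orthogonal_mx h -> orthogonal_mx (g *m h).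
Proof.
by move=> og oh; rewrite /orthogonal_mx trmx_mul mulmxA -(mulmxA g) oh mulmx1.
Qed.

Lemma orthogonal_mx1 : orthogonal_mx (1%:M : 'M[R]_n).
Proof. by rewrite /orthogonal_mx trmx1 mulmx1. Qed.

End DotV.

Lemma orthogonal_trmx (R : comUnitRingType) n (g : 'M[R]_n) :
  orthogonal_mx g -> orthogonal_mx g^T.
Proof. by move=> og; rewrite /orthogonal_mx trmxK; exact: mulmx1C. Qed.

Section RealDotV.
Variables (R : realFieldType) (n : nat).
Implicit Types u v w : 'rV[R]_n.

Lemma sqnorm_ge0 v : 0 <= sqnorm v.
Proof. by rewrite dotvE; apply: sumr_ge0 => j _; rewrite -expr2 sqr_ge0. Qed.

Lemma sqnorm_eq0 v : sqnorm v = 0 -> v = 0.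
Proof.
rewrite dotvE => /eqP; rewrite psumr_eq0 => [/allP v0|j _]; last first.
  by rewrite -expr2 sqr_ge0.
apply/rowP => j; have := v0 j; rewrite mem_index_enum => /(_ isT) /eqP.
by move/eqP; rewrite mulf_eq0 orbb mxE => /eqP.
Qed.

Lemma sqr_coord_le v i : v 0 i ^+ 2 <= sqnorm v.
Proof.
rewrite dotvE (bigD1 i)//= expr2 lerDl; apply: sumr_ge0 => j _.
by rewrite -expr2 sqr_ge0.
Qed.

Lemma sqnormD_le u v : sqnorm (u + v) <= 2 * sqnorm u + 2 * sqnorm v.
Proof.
have := sqnorm_ge0 (u - v).
rewrite !(dotvBl, dotvBr) !(dotvDl, dotvDr) (dotvC v u); lra.
Qed.

Lemma sqnormN v : sqnorm (- v) = sqnorm v.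
Proof. by rewrite /dotv linearN mulmxN mulNmx opprK. Qed.

(** For u <> v this is the reflection in the hyperplane orthogonal to u - v. *)
Lemma householder u v : sqnorm u = sqnorm v ->
  exists h : 'M[R]_n, [/\ orthogonal_mx h, u *m h = v &
    forall z, dotv z u = dotv z v -> z *m h = z].
Proof.
move=> uv; have [->|/eqP nuv] := u =P v.
  by exists 1%:M; split=> [||z _]; rewrite ?mulmx1//; exact: orthogonal_mx1.
pose w := u - v; pose c := sqnorm w.
have c0 : c != 0 by apply/eqP => /sqnorm_eq0 /eqP; rewrite subr_eq0 (negPf nuv).
pose h : 'M[R]_n := 1%:M - (2 / c) *: (w^T *m w).
have hE z : z *m h = z - (2 / c * dotv z w) *: w.
  rewrite mulmxBr mulmx1 -scalemxAr mulmxA mulmx_dotv mul_scalar_mx.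
  by rewrite scalerA.
have hT : h^T = h by rewrite linearB /= linearZ /= trmx_mul trmxK trmx1.
exists h; split.
- apply/row_matrixP => i; rewrite hT !rowE mulmx1 mulmxA !hE.
  set z := delta_mx _ _; rewrite dotvBl.
  have -> : dotv ((2 / c * dotv z w) *: w) w = 2 * dotv z w.
    by rewrite /dotv -scalemxAl mxE -/(dotv w w) -/(dotv z w) -/c; field.
  have -> : dotv z w - 2 * dotv z w = - dotv z w by ring.
  by rewrite mulrN scaleNr opprK subrK.
- rewrite hE.
  have -> : 2 / c * dotv u w = 1.
    suff cE : c = 2 * dotv u w by rewrite mulrAC -cE divff.
    rewrite /c /w !(dotvBl, dotvBr) (dotvC v u) -uv; lra.
  by rewrite scale1r /w subKr.
- by move=> z zuv; rewrite hE /w dotvBr zuv subrr mulr0 scale0r subr0.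
Qed.

(** Two families with the same Gram matrix are congruent. Vectors are
    matched one at a time: the reflection that corrects the new vector fixes
    the vectors already matched, since these have equal products with both
    ends. *)
Lemma orthogonal_extension (I : eqType) (l : seq I) (A B : I -> 'rV[R]_n) :
    {in l &, forall s t, dotv (A s) (A t) = dotv (B s) (B t)} ->
  exists2 g : 'M[R]_n, orthogonal_mx g & {in l, forall s, A s *m g = B s}.
Proof.
elim: l => [|x l IHl] eqd; first by exists 1%:M => //; exact: orthogonal_mx1.
have [|g og gAB] := IHl.
  by move=> s t sl tl; apply: eqd; rewrite inE ?sl ?tl orbT.
have [|h [oh hx hfix]] := @householder (A x *m g) (B x).
  by rewrite dotv_orthogonal// eqd// mem_head.
exists (g *m h); first exact: orthogonal_mxM.
move=> s; rewrite inE mulmxA => /predU1P[->//|sl].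
rewrite gAB// hfix// -(gAB s sl) dotv_orthogonal//.
by rewrite gAB// eqd// ?mem_head// inE sl orbT.
Qed.

End RealDotV.

(** * Almost invariant finite families of orthogonal matrices *)

Definition is_net (T : eqType) (G : T -> Prop) (near : T -> T -> Prop)
    (s : seq T) : Prop :=
  (forall x, x \in s -> G x) /\
  (forall h, G h -> exists2 x, x \in s & near h x).

(** A net of minimal cardinality is almost invariant under every surjection tau
    of G onto itself that preserves nearness.  The image of the net is again a
    net.  If some set of image points had fewer neighbours in the net (points
    with a common near element of G) than it has elements, then substituting
    these neighbours for it in the image net would give a smaller net.  So the
    marriage theorem matches the image with the net. *)
Theorem minimal_net_permuted (T : eqType) (G : T -> Prop)
    (near : T -> T -> Prop) (s0 : seq T) :
    is_net G near s0 ->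
  exists k (x : 'I_k -> T),
    [/\ forall i, G (x i), (forall h, G h -> exists i, near h (x i)) &
     forall tau tau' : T -> T,
       (forall h, G h -> G (tau h)) -> (forall h, G h -> G (tau' h)) ->
       cancel tau' tau -> {homo tau : a b / near a b} ->
     exists2 sigma : 'I_k -> 'I_k, injective sigma &
       forall i, exists h, [/\ G h, near h (tau (x i)) & near h (x (sigma i))]].
Proof.
move=> net0.
pose P k := `[< exists2 s, size s = k & is_net G near s >].
have exP : exists k, P k by exists (size s0); apply/asboolP; exists s0.
case: (ex_minnP exP) => k /asboolP [s sk [sG scov]] kmin.
pose x (i : 'I_k) := tnth (in_tuple s) (cast_ord (esym sk) i).
have xs i : x i \in s by apply: mem_tnth.
have sx y : y \in s -> exists i, y = x i.
  move=> /(@tnthP _ _ (in_tuple s)) [i ->]; exists (cast_ord sk i).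
  by rewrite /x cast_ordK.
exists k, x; split=> [i|h Gh|tau tau' tauG tau'G tauK tau_near].
- exact/sG/xs.
- by have [y /sx [i ->] hy] := scov h Gh; exists i.
pose e := [set p : 'I_k * 'I_k |
  `[< exists h, [/\ G h, near h (tau (x p.1)) & near h (x p.2)] >]].
have [A|f f_inj fe] := @hall _ _ e; last first.
  by exists f => // i; have := fe i; rewrite inE => /asboolP.
rewrite leqNgt; apply/negP => small.
pose s' := [seq x j | j <- enum (neighbours e A)] ++
  [seq tau (x i) | i <- enum (~: A)].
have : P (size s').
  apply/asboolP; exists s' => //; split.
    move=> y; rewrite mem_cat => /orP[] /mapP[i _ ->]; last apply: tauG.
      exact/sG/xs.
    exact/sG/xs.
  move=> h Gh; have [y /sx [i ->] hi] := scov _ (tau'G _ Gh).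
  have {}hi : near h (tau (x i)) by rewrite -[h]tauK; apply: tau_near.
  have [iA|iA] := boolP (i \in A); last first.
    exists (tau (x i)) => //; rewrite mem_cat; apply/orP; right.
    by apply/mapP; exists i; rewrite // mem_enum inE.
  have [y' /sx [j ->] hj] := scov _ Gh.
  exists (x j) => //; rewrite mem_cat; apply/orP; left.
  apply/mapP; exists j; rewrite // mem_enum; apply/neighboursP; exists i => //.
  by rewrite inE; apply/asboolP; exists h.
move/kmin; rewrite size_cat !size_map -!cardE leqNgt => /negP; apply.
rewrite -[X in (_ < X)%N](card_ord k) -(cardC A) -/(~: A).
rewrite (_ : #|[predC A]| = #|~: A|) ?ltn_add2r//.
by apply: eq_card => i; rewrite !inE.
Qed.

(** Closeness in operator norm, with eta a bound on the squared norm; the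
    operator norm is invariant under multiplication by orthogonal matrices. *)
Definition near_mx (R : numDomainType) n (eta : R) (g h : 'M[R]_n) : Prop :=
  forall v : 'rV_n, sqnorm (v *m (g - h)) <= eta * sqnorm v.

Lemma orthogonal_mx_entry (R : realDomainType) n (g : 'M[R]_n) i j :
  orthogonal_mx g -> `|g i j| <= 1.
Proof.
move=> /matrixP /(_ i i); rewrite !mxE eqxx => sum1.
rewrite -(@expr_le1 _ 2)// real_normK ?num_real// -[leRHS]sum1.
rewrite (bigD1 j)//= mxE expr2 lerDl; apply: sumr_ge0 => l _.
by rewrite mxE -expr2 sqr_ge0.
Qed.

Lemma sqnorm_mulmx_le (R : rcfType) n (M : 'M[R]_n) (d : R) (v : 'rV_n) :
    (forall i j, `|M i j| <= d) ->
  sqnorm (v *m M) <= n%:R ^+ 3 * d ^+ 2 * sqnorm v.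
Proof.
move=> Md; have q0 := sqnorm_ge0 v.
have vq i : `|v 0 i| <= Num.sqrt (sqnorm v).
  by rewrite -sqrtr_sqr ler_sqrt// sqr_coord_le.
have entry j : `|(v *m M) 0 j| <= n%:R * (Num.sqrt (sqnorm v) * d).
  rewrite mxE; apply: le_trans (ler_norm_sum _ _ _) _.
  apply: (@le_trans _ _ (\sum_(i < n) Num.sqrt (sqnorm v) * d)).
    by apply: ler_sum => i _; rewrite normrM ler_pM.
  by rewrite sumr_const card_ord mulr_natl.
rewrite [leLHS]dotvE.
apply: (@le_trans _ _ (\sum_(j < n) (n%:R * (Num.sqrt (sqnorm v) * d)) ^+ 2)).
  apply: ler_sum => j _; rewrite -expr2 -[leLHS]real_normK ?num_real//.
  by rewrite ler_sqr ?nnegrE ?(le_trans (normr_ge0 _) (entry j)).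
rewrite sumr_const card_ord -[leLHS]mulr_natl !exprMn sqr_sqrtr//.
by rewrite le_eqVlt; apply/orP; left; apply/eqP; ring.
Qed.

(** Entries of orthogonal matrices lie in [-1, 1]; cut this interval into
    pieces of length 1 / K and keep one orthogonal matrix for each occupied
    cell. *)
Lemma orthogonal_mx_net (R : realType) n (eta : R) : 0 < eta ->
  exists s : seq 'M[R]_n, is_net (@orthogonal_mx R n) (near_mx eta) s.
Proof.
move=> eta0.
pose K := (Num.truncn (n%:R ^+ 3 / eta)).+1.
have K0 : 0 < K%:R :> R by rewrite ltr0n.
have leK : n%:R ^+ 3 * (K%:R^-1) ^+ 2 <= eta.
  have hK : n%:R ^+ 3 < eta * K%:R.
    by rewrite mulrC -ltr_pdivrMr ?truncnS_gt.
  rewrite exprVn ler_pdivrMr ?exprn_gt0//; apply: le_trans (ltW hK) _.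
  by rewrite ler_pM2l// expr2 ler_peMl ?ler1n// ltW.
pose cell (h : 'M[R]_n) : {ffun 'I_n * 'I_n -> 'I_(K + K).+1} :=
  [ffun p => inord (Num.truncn ((h p.1 p.2 + 1) * K%:R))].
have cellP h h' : orthogonal_mx h -> orthogonal_mx h' -> cell h = cell h' ->
    near_mx eta h h'.
  move=> oh oh' hh' v.
  apply: le_trans (sqnorm_mulmx_le v (d := K%:R^-1) _) _; last first.
    by rewrite ler_wpM2r ?sqnorm_ge0.
  move=> i j; rewrite !mxE.
  have bnd (g : 'M[R]_n) : orthogonal_mx g ->
      (cell g (i, j))%:R <= (g i j + 1) * K%:R < (cell g (i, j)).+1%:R.
    move=> og; have := orthogonal_mx_entry i j og.
    rewrite ler_norml => /andP[lo hi].
    have ge0 : 0 <= (g i j + 1) * K%:R by rewrite mulr_ge0 ?(ltW K0)//; lra.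
    have/andP[t1 t2] := truncn_itv ge0.
    rewrite ffunE /= inordK ?t1 ?t2//.
    rewrite ltnS -(ler_nat R); apply: le_trans t1 _.
    by rewrite natrD -mulr2n -[leRHS]mulr_natl ler_wpM2r ?(ltW K0)//; lra.
  have := bnd h oh; have := bnd h' oh'; rewrite hh'.
  set m := cell h' _; rewrite -natr1 => /andP[a b] /andP[c d].
  rewrite -[leRHS]mul1r ler_pdivlMr// -[K%:R]gtr0_norm// -normrM ler_norml.
  by apply/andP; split; lra.
pose rep c : 'M[R]_n :=
  if pselect (exists2 h, orthogonal_mx h & cell h = c) is left ex
  then sval (cid2 ex) else 1%:M.
have repP h : orthogonal_mx h ->
    orthogonal_mx (rep (cell h)) /\ cell (rep (cell h)) = cell h.
  move=> oh; rewrite /rep; case: pselect => [ex|[]]; last by exists h.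
  by case: cid2.
exists [seq rep c | c <- enum {: {ffun 'I_n * 'I_n -> 'I_(K + K).+1}}]; split.
  move=> g /mapP [c _ ->]; rewrite /rep; case: pselect => [ex|_].
    by case: cid2.
  exact: orthogonal_mx1.
move=> h oh; have [orep crep] := repP h oh.
exists (rep (cell h)); last exact: cellP.
by apply/mapP; exists (cell h) => //; rewrite mem_enum.
Qed.

(** A finite substitute for the Haar measure of the orthogonal group: left
    translations act on the family x as permutations, up to a small error. *)
Theorem quasi_invariant_family (R : realType) n (eta : R) : 0 < eta ->
  exists k (x : 'I_k -> 'M[R]_n),
    [/\ (0 < k)%N, forall i, orthogonal_mx (x i) &
     forall g, orthogonal_mx g -> exists2 sigma : 'I_k -> 'I_k,
       injective sigma & forall i, near_mx eta (g *m x i) (x (sigma i))].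
Proof.
(* Two steps of squared length eta / 4 make one of squared length eta. *)
move=> eta0; have eta4 : 0 < eta / 4 by rewrite divr_gt0.
have [s0 /minimal_net_permuted [k [x [xG xcov xperm]]]] :=
  orthogonal_mx_net n eta4.
exists k, x; split=> //.
  by have [i _] := xcov _ (orthogonal_mx1 _ _); apply: leq_trans (ltn_ord i).
move=> g og.
have [||||sigma sinj sP] := xperm (mulmx g) (mulmx g^T).
- by move=> h; apply: orthogonal_mxM.
- by move=> h; apply: orthogonal_mxM; exact: orthogonal_trmx.
- by move=> h; rewrite mulmxA og mul1mx.
- move=> a b ab v; rewrite -mulmxBr mulmxA; apply: le_trans (ab _) _.
  by rewrite dotv_orthogonal.
exists sigma => // i v; have [h [_ h1 h2]] := sP i.
have -> : v *m (g *m x i - x (sigma i)) =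
    v *m (h - x (sigma i)) + - (v *m (h - g *m x i)).
  by rewrite -mulmxBr opprB [in RHS]addrC addrA subrK.
apply: le_trans (sqnormD_le _ _) _; rewrite sqnormN.
have := h1 v; have := h2 v; lra.
Qed.

Local Open Scope classical_set_scope.
Local Open Scope ring_scope.

(** * Orthonormal families in inner product spaces *)

Section Orthonormal.
Context {R : realType} {H : normedModType R} (dot : {dot H for idfun}).
Hypothesis hdot : inner_product_norm dot.

Lemma dotC x y : dot x y = dot y x.
Proof. by rewrite hermC expr0 mul1r. Qed.

Lemma dotDl x y z : dot (x + y) z = dot x z + dot y z.
Proof. exact: linearDl. Qed.

Lemma dotZl a x y : dot (a *: x) y = a * dot x y.
Proof. exact: linearZl_LR. Qed.

Lemma dotBl x y z : dot (x - y) z = dot x z - dot y z.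
Proof. exact: linearBl. Qed.

Lemma dotZr a x y : dot x (a *: y) = a * dot x y.
Proof. by rewrite dotC dotZl dotC. Qed.

Lemma dot_suml (I : Type) (r : seq I) (P : pred I) (E : I -> H) y :
  dot (\sum_(i <- r | P i) E i) y = \sum_(i <- r | P i) dot (E i) y.
Proof. exact: linear_sumlz. Qed.

Lemma dot_sumr (I : Type) (r : seq I) (P : pred I) (E : I -> H) y :
  dot y (\sum_(i <- r | P i) E i) = \sum_(i <- r | P i) dot y (E i).
Proof. by rewrite dotC dot_suml; apply: eq_bigr => i _; rewrite dotC. Qed.

Definition orthonormal_family (I : eqType) (f : I -> H) : Prop :=
  forall i j, dot (f i) (f j) = (i == j)%:R.

Lemma norm_orthonormal_sum (I : finType) (f : I -> H) (c : I -> R) :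
  orthonormal_family f -> `|\sum_i c i *: f i| ^+ 2 = \sum_i c i ^+ 2.
Proof.
move=> of_; rewrite hdot dot_suml; apply: eq_bigr => i _.
rewrite dot_sumr (bigD1 i)//= dotZl dotZr of_ eqxx mulr1 -expr2 big1 ?addr0//.
by move=> j ji; rewrite dotZl dotZr of_ (eq_sym i j) (negPf ji) !mulr0.
Qed.

Definition expansion n (b : 'I_n -> H) (x : H) : H := \sum_i dot x (b i) *: b i.

Lemma gram_schmidt_step n (b : 'I_n -> H) (x : H) :
    orthonormal_family b -> x <> expansion b x ->
  exists b' : 'I_n.+1 -> H, [/\ orthonormal_family b',
    x = expansion b' x & forall z, z = expansion b z -> z = expansion b' z].
Proof.
move=> ob xnb; pose u := x - expansion b x.
have u0 : `|u| != 0 by rewrite normr_eq0 subr_eq0; apply/eqP.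
pose e := `|u|^-1 *: u.
have ub i : dot u (b i) = 0.
  rewrite dotBl dot_suml (bigD1 i)//= dotZl ob eqxx mulr1 big1 ?addr0 ?subrr//.
  by move=> j ji; rewrite dotZl ob (negPf ji) mulr0.
have eb i : dot e (b i) = 0 by rewrite dotZl ub mulr0.
have ee : dot e e = 1.
  by rewrite -hdot /e normrZ normfV normr_id mulVf// expr1n.
pose b' (i : 'I_n.+1) := if unlift ord_max i is Some j then b j else e.
have b'E z : expansion b' z = expansion b z + dot z e *: e.
  rewrite /expansion big_ord_recr /= /b' unlift_none; congr (_ + _).
  apply: eq_bigr => i _.
  have -> : widen_ord (leqnSn n) i = lift ord_max i.
    by apply: val_inj; rewrite /= /bump leqNgt ltn_ord.
  by rewrite liftK.
exists b'; split.
- move=> i j; rewrite /b'.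
  case: unliftP => [i' ->|->]; case: unliftP => [j' ->|->].
  + by rewrite ob (inj_eq lift_inj).
  + by rewrite dotC eb eq_sym eq_liftF.
  + by rewrite eb eq_liftF.
  + by rewrite ee eqxx.
- have xe : x = expansion b x + `|u| *: e.
    by rewrite /e scalerA divff// scale1r /u addrC subrK.
  rewrite b'E {1}xe; congr (_ + _ *: _).
  rewrite [X in dot X e]xe dotDl dotZl ee mulr1 dot_suml big1 ?add0r// => i _.
  by rewrite dotZl (dotC (b _)) eb mulr0.
- move=> z zb; rewrite b'E -zb.
  have -> : dot z e = 0.
    by rewrite zb dot_suml big1// => i _; rewrite dotZl (dotC (b _)) eb mulr0.
  by rewrite scale0r addr0.
Qed.

Lemma orthonormal_basis (l : seq H) :
  exists n (b : 'I_n -> H), orthonormal_family b /\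
    {in l, forall z, z = expansion b z}.
Proof.
elim: l => [|x l [n [b [ob lb]]]].
  by exists 0%N, (fun=> 0); split=> // -[].
have [xb|xnb] := pselect (x = expansion b x).
  by exists n, b; split=> // z; rewrite inE => /predU1P[->|/lb].
have [b' [ob' xb' bb']] := gram_schmidt_step ob xnb.
by exists n.+1, b'; split=> // z; rewrite inE => /predU1P[->//|/lb/bb'].
Qed.

Lemma orthonormal_family_exists (I : finType) :
  infinite_dimensional H -> exists f : I -> H, orthonormal_family f.
Proof.
move=> hinf; suff [f of_] : exists f : 'I_#|I| -> H, orthonormal_family f.
  by exists (f \o enum_rank) => i j; rewrite of_ (inj_eq enum_rank_inj).
elim: #|I| => [|n [b ob]]; first by exists (fun=> 0) => -[].
have [x xnb] : exists x, x <> expansion b x.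
  apply/existsNP => bx; apply: hinf.
  exists [seq b i | i <- enum 'I_n] => x.
  have sz : size [seq b i | i <- enum 'I_n] = n.
    by rewrite size_map size_enum_ord.
  exists (fun i => dot x (b (cast_ord sz i))).
  rewrite {1}(bx x) /expansion (reindex (cast_ord sz)).
    apply: eq_bigr => i _; rewrite (nth_map (cast_ord sz i)) ?size_enum_ord.
      by rewrite (nth_ord_enum _ (cast_ord sz i)).
    by rewrite -[X in (_ < X)%N]sz.
  apply: onW_bij; exists (cast_ord (esym sz)); first exact: cast_ordK.
  exact: cast_ordKV.
by have [b' [ob' _ _]] := gram_schmidt_step ob xnb; exists b'.
Qed.

Definition coords n (b : 'I_n -> H) (x : H) : 'rV[R]_n := \row_j dot x (b j).

Lemma sqnorm_coords n (b : 'I_n -> H) x :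
  orthonormal_family b -> x = expansion b x -> sqnorm (coords b x) = `|x| ^+ 2.
Proof.
move=> ob xb; rewrite [in RHS]xb norm_orthonormal_sum// dotvE.
by apply: eq_bigr => i _; rewrite mxE expr2.
Qed.

Lemma coordsB n (b : 'I_n -> H) x y :
  coords b (x - y) = coords b x - coords b y.
Proof. by apply/rowP => j; rewrite !mxE dotBl. Qed.

Lemma expansionB n (b : 'I_n -> H) x y :
  expansion b (x - y) = expansion b x - expansion b y.
Proof.
by rewrite /expansion -sumrB; apply: eq_bigr => i _; rewrite dotBl scalerBl.
Qed.

(** The orthonormal family f identifies the sum of N copies of R^n with a
    subspace of H; the normalisation makes v |-> (v, ..., v) isometric. *)
Definition block_sum N n (f : 'I_N * 'I_n -> H) (a : 'I_N -> 'rV[R]_n) : H :=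
  (Num.sqrt N%:R)^-1 *: \sum_p a p.1 0 p.2 *: f p.

Lemma block_sumB N n (f : 'I_N * 'I_n -> H) (a a' : 'I_N -> 'rV[R]_n) :
  block_sum f a - block_sum f a' = block_sum f (fun t => a t - a' t).
Proof.
rewrite /block_sum -scalerBr -sumrB; congr (_ *: _); apply: eq_bigr => p _.
by rewrite !mxE scalerBl.
Qed.

Lemma norm_block_sum N n (f : 'I_N * 'I_n -> H) (a : 'I_N -> 'rV[R]_n) :
  orthonormal_family f ->
  `|block_sum f a| ^+ 2 = N%:R^-1 * \sum_t sqnorm (a t).
Proof.
move=> of_; rewrite normrZ exprMn norm_orthonormal_sum// normfV.
rewrite ger0_norm ?sqrtr_ge0// exprVn sqr_sqrtr//; congr (_ * _).
rewrite -(pair_bigA _ (fun t j => a t 0 j ^+ 2)) /=; apply: eq_bigr => t _.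
by rewrite dotvE; apply: eq_bigr => j _; rewrite expr2.
Qed.

End Orthonormal.

(** * Embeddings indexed by words *)

Lemma copy_dist_lt (R : realType) (H : normedModType R) (F : set H)
    (i j : H -> H) (eps : R) :
    finite_set F -> isometric_embedding F i -> isometric_embedding F j ->
    0 < eps -> (forall x, F x -> `|i x - j x| < eps) ->
  copy_dist F (i @` F) (j @` F) < eps.
Proof.
move=> finF iF jF eps0 close_ij.
apply: (@le_lt_trans _ _ (dsup F i j)).
  apply: ge_inf; last by exists i, j; split.
  exists 0 => _ [i' [j' [_ _ _ _ ->]]].
  by apply: bigmax_ge_id.
rewrite /dsup big_seq; apply: bigmax_lt => // x.
rewrite in_fset_set// inE => Fx; exact: close_ij.
Qed.

Lemma dotv_polarization (R : realFieldType) n (u v : 'rV[R]_n) :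
  dotv u v = (sqnorm u + sqnorm v - sqnorm (u - v)) / 2.
Proof. by rewrite !(dotvBl, dotvBr) (dotvC v u); field. Qed.

Theorem corollary6p14 (R : realType) (H : completeNormedModType R)
    (dot : {dot H for idfun}) (hdot : inner_product_norm dot)
    (hinf : infinite_dimensional H)
    (F : set H) (finF : finite_set F) (FS : F `<=` sphere1)
    (gamma : set (set (set H))) (fin_gamma : finite_set gamma)
    (part_gamma : partition gamma id (copies F))
    (Y : set H) (finY : finite_set Y) (YS : Y `<=` sphere1)
    (eps : R) (eps_gt0 : 0 < eps) :
  exists2 Y' : set H, copies Y Y' &
    monochromatic_upto F gamma eps [set F' | copies F F' /\ F' `<=` Y'].
Proof.
have [sF FE] := (finite_seqP F).1 finF.
have [sY YE] := (finite_seqP Y).1 finY.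
have [sg gE] := (finite_seqP gamma).1 fin_gamma.
have [n [b [ob bE]]] := orthonormal_basis hdot (sF ++ sY).
pose cd := coords dot b.
have cdB y z : y \in sF ++ sY -> z \in sF ++ sY ->
    sqnorm (cd y - cd z) = `|y - z| ^+ 2.
  move=> /bE yE /bE zE; rewrite -coordsB sqnorm_coords//.
  by rewrite expansionB -yE -zE.
have inF (s : seq_sub sF) : val s \in sF ++ sY by rewrite mem_cat (valP s).
have inY (s : seq_sub sY) : val s \in sF ++ sY by rewrite mem_cat (valP s) orbT.
have Fval x : F x -> exists s : seq_sub sF, val s = x.
  by rewrite FE => /= xs; exists (SeqSub xs).
have Yval x : Y x -> exists s : seq_sub sY, val s = x.
  by rewrite YE => /= xs; exists (SeqSub xs).
have valF (s : seq_sub sF) : F (val s) by rewrite FE /=; exact: (valP s).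
have valY (s : seq_sub sY) : Y (val s) by rewrite YE /=; exact: (valP s).
have cd1 y : y \in sF ++ sY -> sqnorm (cd y) = 1.
  move=> yFY; rewrite sqnorm_coords//; last exact: bE.
  move: yFY; rewrite mem_cat => /orP[ys|ys].
    by have -> : `|y| = 1 by [apply: FS; rewrite FE]; rewrite expr1n.
  by have -> : `|y| = 1 by [apply: YS; rewrite YE]; rewrite expr1n.
(* The maps e range over a finite type; those that are isometric are the
   embeddings of F into Y, and each of them extends to a rotation g e of the
   coordinate space. *)
pose isom (e : {ffun seq_sub sF -> seq_sub sY}) :=
  forall s t, `|val (e s) - val (e t)| = `|val s - val t|.
have /choice [g gP] : forall e, exists h : 'M[R]_n, orthogonal_mx h /\
    (isom e -> forall s, cd (val s) *m h = cd (val (e s))).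
  move=> e; have [ie|nie] := pselect (isom e); last first.
    by exists 1%:M; split=> //; exact: orthogonal_mx1.
  have [|h oh hP] := @orthogonal_extension R n _ (enum {: seq_sub sF})
      (fun s => cd (val s)) (fun s => cd (val (e s))).
    move=> s t _ _; cbv beta.
    by rewrite [LHS]dotv_polarization [RHS]dotv_polarization !cdB ?cd1 ?ie.
  by exists h; split=> // _ s; apply: hP; rewrite mem_enum.
(* The final estimate is eta + 4 * delta < eps ^+ 2, with eta = eps ^+ 2 / 4 and
   delta = eps ^+ 2 / 16. *)
have eta0 : 0 < eps ^+ 2 / 4 by rewrite divr_gt0// exprn_gt0.
have [k [x [k0 xO xP]]] := quasi_invariant_family n eta0.
have /choice [sigma sP] : forall e, exists s : 'I_k -> 'I_k,
    injective s /\ forall i, near_mx (eps ^+ 2 / 4) (g e *m x i) (x (s i)).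
  by move=> e; have [s s1 s2] := xP _ (gP e).1; exists s.
have delta0 : 0 < eps ^+ 2 / 16 by rewrite divr_gt0// exprn_gt0.
have [N N0 mono] := near_monochromatic (T := 'I_k) (seq_sub sg) (Ordinal k0)
  (fun e => (sP e).1) delta0.
have [f of_] := orthonormal_family_exists hdot ('I_N * 'I_n)%type hinf.
pose emb (w : N.-tuple 'I_k) (y : H) : H :=
  block_sum f (fun t => cd y *m x (tnth w t)).
have N0R : 0 < N%:R :> R by rewrite ltr0n.
have emb_isom w (A : set H) :
    A `<=` [set` sF ++ sY] -> isometric_embedding A (emb w).
  move=> AFY; split=> [y Ay|y z Ay Az].
    apply/eqP; rewrite -sqrp_eq1// (norm_block_sum hdot)//.
    under eq_bigr => t _ do rewrite dotv_orthogonal// cd1 ?(AFY _ Ay)//.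
    by rewrite sumr_const card_ord mulVf// gt_eqF.
  apply/eqP; rewrite -(@eqrXn2 _ 2)// block_sumB (norm_block_sum hdot)//.
  under eq_bigr => t _ do
    rewrite -mulmxBl dotv_orthogonal// cdB ?(AFY _ Ay)// ?(AFY _ Az)//.
  by rewrite sumr_const card_ord -[X in _ * X]mulr_natl mulKf// gt_eqF.
have embF w : isometric_embedding F (emb w).
  by apply: emb_isom => y Fy; rewrite /= mem_cat; move: Fy; rewrite FE /= => ->.
have embY w : isometric_embedding Y (emb w).
  apply: emb_isom => y Yy; rewrite /= mem_cat; move: Yy; rewrite YE /= => ->.
  by rewrite orbT.
have /choice [chi chiP] : forall w, exists c : seq_sub sg, val c (emb w @` F).
  move=> w; case: part_gamma => cov _ _.
  have : copies F (emb w @` F) by exists (emb w).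
  rewrite -cov => -[P gP' PF]; move: gP'; rewrite gE /= => Psg.
  by exists (SeqSub Psg).
have [w [c wP]] := mono chi.
exists (emb w @` Y); first by exists (emb w).
exists (val c); first by rewrite gE /=; exact: (valP c).
move=> F' [[i iF iF'] F'Y]; split; first by exists i.
have /choice [e0 e0P] : forall s : seq_sub sF, exists t : seq_sub sY,
    emb w (val t) = i (val s).
  move=> s; have : F' (i (val s)) by rewrite -iF'; exists (val s).
  by move=> /F'Y [y /Yval [t <-]] <-; exists t.
pose e := [ffun s => e0 s].
have eP s : emb w (val (e s)) = i (val s) by rewrite ffunE e0P.
have ie : isom e.
  by move=> s t; rewrite -(embY w).2// !eP iF.2.
have [w' chi_w' w'P] := wP e.
exists (emb w' @` F); first by rewrite -chi_w'.
rewrite -iF'; apply: copy_dist_lt => // y /Fval [s <-].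
rewrite -(@ltr_pXn2r _ 2) ?nnegrE ?(ltW eps_gt0)// -eP block_sumB.
rewrite (norm_block_sum hdot)//.
(* By the choice of e, both points come from the coordinates of s, once
   through g e *m x (w t) and once through x (w' t).  These matrices are near
   when w' t is the image of w t under sigma e; otherwise the squared distance
   of two unit vectors is at most 4, and this happens for few t. *)
have term t : sqnorm
      (cd (val (e s)) *m x (tnth w t) - cd (val s) *m x (tnth w' t)) <=
    eps ^+ 2 / 4 + 4 * (tnth (map_tuple (sigma e) w) t != tnth w' t)%:R.
  rewrite -((gP e).2 ie); case: eqP => [|_]; last first.
    rewrite mulr1; apply: le_trans (sqnormD_le _ _) _.
    rewrite sqnormN !dotv_orthogonal//; last exact: (gP e).1.
    by rewrite cd1//; lra.
  rewrite tnth_map => <-; have := (sP e).2 (tnth w t) (cd (val s)).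
  by rewrite mulmxBr mulmxA cd1// mulr0 addr0 mulr1.
rewrite mulrC ltr_pdivrMr//.
apply: le_lt_trans (ler_sum _ (fun t _ => term t)) _.
rewrite big_split /= sumr_const card_ord -mulr_sumr -natr_sum -/(hamming _ _).
have : 0 < eps ^+ 2 * N%:R by rewrite mulr_gt0// exprn_gt0.
move: w'P; rewrite -[_ *+ N]mulr_natl; lra.
Qed.
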